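(* Let $k \geq 3$ be an integer, let $C_{4,k}$ be the $k$-uniform hypercycle with length four, and let $\mathcal{A}_{C_{4,k}}$ be its adjacency tensor. Then the $k$-th order trace of $\mathcal{A}_{C_{4,k}}$ is $$\mathrm{Tr}_{k}(\mathcal{A}_{C_{4,k}})=4k^{k-1}(k-1)^{3k-4}.$$
   Context: A $k$-uniform hypergraph $H=(V,E)$ is a finite vertex set $V$ together with a set $E$ of $k$-element subsets of $V$ (edges). The $k$-uniform hypercycle with length $m$, $C_{m,k}$, has vertices $v_1,v_2,\ldots,v_{m(k-1)+1}$ with $v_1=v_{m(k-1)+1}$ identified (and no other identifications), and edges $e_i=\{v_{(i-1)(k-1)+1},v_{(i-1)(k-1)+2},\ldots,v_{i(k-1)+1}\}$ for $i=1,\ldots,m$; equivalently it is obtained from the cycle graph of length $m$ by adding $k-2$ new vertices to every edge. Thus $C_{4,k}$ has $n=4(k-1)$ vertices and $4$ edges. The adjacency tensor of a $k$-uniform hypergraph $H$ on $n$ vertices (labelled $1,\ldots,n$) is the $k$-order $n$-dimensional tensor $\mathcal{A}_H=(a_{i_1i_2\ldots i_k})$ with $a_{i_1\ldots i_k}=\frac{1}{(k-1)!}$ if $\{i_1,\ldots,i_k\}\in E$ and $0$ otherwise. For a $k$-order $n$-dimensional tensor $\mathcal{T}=(t_{i_1\ldots i_k})$ over $\mathbb{C}$, the $j$-th order trace is $$\mathrm{Tr}_{j}(\mathcal{T})=(k-1)^{n-1}\sum_{j_{1}+\cdots+j_{n}=j}\Big[\prod_{i=1}^{n}\frac{1}{(j_{i}(k-1))!}\Big(\sum_{l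 \in [n]^{k-1}}t_{il}\frac{\partial}{\partial x_{il}}\Big)^{j_{i}}\Big] \mathrm{tr}(X^{j(k-1)}),$$ where $X=(x_{ij})$ is an $n\times n$ matrix of independent variables, $[n]=\{1,\ldots,n\}$, for $l=l_2\cdots l_k$ one writes $t_{il}=t_{il_2\ldots l_k}$ and $\frac{\partial}{\partial x_{il}}=\frac{\partial}{\partial x_{il_2}}\cdots\frac{\partial}{\partial x_{il_k}}$, and $j_1,\ldots,j_n$ run over all nonnegative integers with sum $j$. *)

(* Defs.v *)
From mathcomp Require Import all_boot all_order all_algebra.
From mathcomp Require Import mpoly.

Set Implicit Arguments.
Unset Strict Implicit.
Unset Printing Implicit Defensive.

Import GRing.Theory.
Local Open Scope ring_scope.

(* An order-k dimension-n tensor (t_{i_1 ... i_k}), k >= 1: the value at [i] and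
   [l] is t_{il}, where i = i_1 and l = i_2 ... i_k. *)
Definition tensor (R : Type) (k n : nat) := 'I_n -> k.-1.-tuple 'I_n -> R.

Record hypergraph (k : nat) (V : finType) := Hypergraph {
  edges : {set {set V}};
  edges_card : forall e, e \in edges -> #|e| = k
}.

Definition adjacency_tensor (F : fieldType) (k n : nat)
    (H : hypergraph k 'I_n) : tensor F k n :=
  fun i l => if [set x in i :: l] \in edges H then (k.-1)`!%:R^-1 else 0.

(* Indices are shifted to start at 0: the vertex v_{a+1} is the element
   a %% (m * k.-1), so that v_{m(k-1)+1} = v_1, and the edge e_{i+1} consists of
   v_{i(k-1)+t+1} for 0 <= t < k. *)
Definition hypercycle_edge (m k i : nat) : {set 'I_(m * k.-1)} :=
  [set v : 'I_(m * k.-1) | [exists t : 'I_k, v == (i * k.-1 + t) %% (m * k.-1) :> nat]]%N.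

Lemma hypercycle_edge_card (m k i : nat) :
  (1 < m)%N -> (1 < k)%N -> #|hypercycle_edge m k i| = k.
Proof.
move=> m_gt1 k_gt1.
have n_gt0 : (0 < m * k.-1)%N by rewrite muln_gt0 (ltnW m_gt1) -ltnS prednK // ltnW.
have le_k_n : (k <= m * k.-1)%N.
  apply: (@leq_trans (2 * k.-1)); last by rewrite leq_mul2r m_gt1 orbT.
  by case: k k_gt1 {n_gt0} => [|[|k]] //= _; rewrite mul2n -addnn addSnnS leq_addl.
pose f (t : 'I_k) : 'I_(m * k.-1) := Ordinal (ltn_pmod (i * k.-1 + t) n_gt0).
have f_inj : injective f.
  move=> s t /(congr1 val) /= /eqP; rewrite eqn_modDl.
  by rewrite !modn_small ?(leq_trans (ltn_ord _) le_k_n) // => /eqP/val_inj.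
have -> : hypercycle_edge m k i = [set f t | t : 'I_k].
  apply/setP=> v; rewrite inE; apply/existsP/imsetP => [[t /eqP vE]|[t _ ->]].
    by exists t => //; apply: val_inj.
  by exists t; rewrite /= eqxx.
by rewrite card_imset // card_ord.
Qed.

Lemma hypercycle_uniform (m k : nat) : (1 < m)%N -> (1 < k)%N ->
  forall e, e \in [set hypercycle_edge m k i | i : 'I_m] -> #|e| = k.
Proof. by move=> m1 k1 _ /imsetP[i _ ->]; apply: hypercycle_edge_card. Qed.

Definition hypercycle (m k : nat) (m_gt1 : (1 < m)%N) (k_gt1 : (1 < k)%N) :
    hypergraph k 'I_(m * k.-1) :=
  Hypergraph (hypercycle_uniform m_gt1 k_gt1).

Section Trace.
Variables (F : fieldType) (k n : nat).

(* The ring of polynomials in the independent variables x_{ij}, i, j < n; the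
   variable x_{ij} has index [mxvec_index i j : 'I_(n * n)]. *)
Local Notation P := {mpoly F[n * n]}.

Definition generic_mx : 'M[P]_n := \matrix_(i, j) 'X_(mxvec_index i j).

(* d/dx_{il} = d/dx_{i l_2} ... d/dx_{i l_k} *)
Definition pderiv (i : 'I_n) (l : seq 'I_n) : P -> P :=
  foldr (fun a D => mderiv (mxvec_index i a) \o D) id l.

Definition tensor_op (T : tensor F k n) (i : 'I_n) : P -> P :=
  fun p => \sum_(l : k.-1.-tuple 'I_n) T i l *: pderiv i l p.

(* The j-th order trace.  Products and powers of differential operators are
   composition and iteration.  The defining formula produces a polynomial in the
   x_{ij}; it is constant, because operators of total order j(k-1) are applied to
   a form of degree j(k-1), and a scalar c is represented by [c%:MP]. *)
Definition tensor_trace (j : nat) (T : tensor F k n) : P :=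
  (k.-1 ^ n.-1)%:R *:
    \sum_(d : {ffun 'I_n -> 'I_j.+1} | (\sum_(i < n) d i)%N == j)
      (\big[@comp P P P / @id P]_(i < n)
         (fun p => (d i * k.-1)`!%:R^-1 *: iter (d i) (tensor_op T i) p))
      (\tr (generic_mx ^+ (j * k.-1))).

End Trace.

(* Main.v *)
Require Import Defs.
From mathcomp Require Import all_boot all_order all_algebra.
From mathcomp Require Import mpoly.
From mathcomp Require Import zify ring.
Local Open Scope ring_scope.

(** The trace is a sum, over choices of [k] rooted edges, of derivatives of
    [\tr (X ^+ (k * k.-1))] by the monomials whose arcs go from the root of each
    chosen edge to its other vertices.  Such a derivative counts closed Eulerian
    walks, so it vanishes unless in- and outdegrees agree; this forces each root
    to lie in all [k] edges, whence a single edge [e] is chosen [k] times, once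
    from each of its vertices.  The arcs then form the complete digraph on [e],
    whose Eulerian walks are counted by a BEST-type determinant. *)

Set Implicit Arguments.
Unset Strict Implicit.
Unset Printing Implicit Defensive.

Import GRing.Theory Num.Theory.

(** * Walks as coefficients of powers of the generic matrix *)

Section Walks.
Variables (F : numFieldType) (n : nat).
Implicit Types (m : 'X_{1..n * n}) (u v w r : 'I_n) (N : nat).

Local Notation x u w := (mxvec_index u w).
Local Notation X := (generic_mx F n).

(** A monomial is read as a multidigraph on ['I_n]: [m (x u w)] is the multiplicity of the arc from
    [u] to [w]. *)
Definition outdeg m u : nat := \sum_w m (x u w).
Definition indeg m u : nat := \sum_w m (x w u).
Definition mfact m : nat := \prod_i (m i)`!.

Lemma mxvec_index_inj u w u' w' :
  (x u w == x u' w') = (u == u') && (w == w').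
Proof.
rewrite -xpair_eqE; apply/eqP/eqP => [|[-> ->] //].
by have [g gK _] := curry_mxvec_bij n n; exact: (can_inj (fun p => gK p isT)) (u, w) (u', w').
Qed.

Lemma mdeg_outdeg m : mdeg m = (\sum_u outdeg m u)%N.
Proof.
rewrite mdegE pair_bigA /= (reindex (uncurry (@mxvec_index n n))) /=.
  by apply: eq_bigr => -[].
by have [g gK Kg] := curry_mxvec_bij n n; exists g => ? _; [apply: gK | apply: Kg].
Qed.

Lemma outdeg0 u : outdeg 0%MM u = 0%N.
Proof. by rewrite /outdeg big1 // => w _; rewrite mnm0E. Qed.

Lemma indeg0 u : indeg 0%MM u = 0%N.
Proof. by rewrite /indeg big1 // => w _; rewrite mnm0E. Qed.

Lemma outdegD m m' u : outdeg (m + m')%MM u = (outdeg m u + outdeg m' u)%N.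
Proof. by rewrite -big_split /=; apply: eq_bigr => w _; rewrite mnmDE. Qed.

Lemma indegD m m' u : indeg (m + m')%MM u = (indeg m u + indeg m' u)%N.
Proof. by rewrite -big_split /=; apply: eq_bigr => w _; rewrite mnmDE. Qed.

Lemma outdegU v w u : outdeg U_(x v w)%MM u = (u == v).
Proof.
rewrite /outdeg (bigD1 w) //= big1 => [|w' /negbTE ne].
  by rewrite mnm1E mxvec_index_inj eqxx andbT addn0 eq_sym.
by rewrite mnm1E mxvec_index_inj [w == _]eq_sym ne andbF.
Qed.

Lemma indegU v w u : indeg U_(x v w)%MM u = (u == w).
Proof.
rewrite /indeg (bigD1 v) //= big1 => [|w' /negbTE ne].
  by rewrite mnm1E mxvec_index_inj eqxx addn0 eq_sym.
by rewrite mnm1E mxvec_index_inj [v == _]eq_sym ne.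
Qed.

Lemma mfactU m v w :
  mfact (m + U_(x v w))%MM = ((m (x v w)).+1 * mfact m)%N.
Proof.
rewrite /mfact (bigD1 (x v w)) //= [in RHS](bigD1 (x v w)) //= mnmDE mnm1E eqxx addn1 factS -mulnA.
congr (_ * (_ * _))%N; apply: eq_bigr => i /negbTE ne.
by rewrite mnmDE mnm1E eq_sym ne addn0.
Qed.

Lemma mcoeffXM (i : 'I_(n * n)) (p : {mpoly F[n * n]}) m :
  ('X_i * p)@_m = if (0 < m i)%N then p@_(m - U_(i)) else 0.
Proof.
rewrite mulrC; case: ifP => [mi_gt0|/negbT mi0].
  have {1}-> : m = (U_(i) + (m - U_(i)))%MM by rewrite addmC submK // lep1mP -lt0n.
  exact: mcoeffMX.
apply: memN_msupp_eq0; apply: contra mi0.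
rewrite (perm_mem (msuppMX _ _)) => /mapP[m' _ ->].
by rewrite mnmDE mnm1E eqxx.
Qed.

(** The coefficient of [m] in [(X ^+ N) v r] counts the walks of [N] steps from [v] to [r] whose
    arcs form [m]; such a walk is split at its first arc. *)
Lemma mcoeff_walkS N v r m :
  ((X ^+ N.+1) v r)@_m =
  \sum_(w | (0 < m (x v w))%N) ((X ^+ N) w r)@_(m - U_(x v w)).
Proof.
rewrite exprS mxE raddf_sum [RHS]big_mkcond /=.
by apply: eq_bigr => w _; rewrite mxE mcoeffXM.
Qed.

Lemma mcoeff_walk0 v r m : ((X ^+ 0) v r)@_m = ((m == 0%MM) && (v == r))%:R.
Proof.
rewrite expr0 mxE mcoeffMn mcoeff1; by do 2 case: eqP.
Qed.

(** Degree condition for an Eulerian walk from [v] to [r], written additively to avoid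
    subtraction. *)
Definition balanced v r m :=
  [forall u, outdeg m u + (u == r) == indeg m u + (u == v)]%N.

Lemma balanced_closed r m : balanced r r m -> outdeg m =1 indeg m.
Proof. by move=> /forallP bal u; have := bal u; rewrite eqn_add2r => /eqP. Qed.

Lemma balanced_step v w r m :
  balanced v r (m + U_(x v w))%MM = balanced w r m.
Proof.
apply: eq_forallb => u; rewrite outdegD indegD outdegU indegU.
by move: (u == v) (u == w) (u == r) => a b c; lia.
Qed.

(** Taking off a first arc from [v] to [w] lowers the degree by one and moves the start to [w],
    which [balanced_step] tracks. *)
Lemma mcoeff_walk_neq0 N v r m : ((X ^+ N) v r)@_m != 0 ->
  (mdeg m == N) && balanced v r m.
Proof.
elim: N v m => [|N IHN] v m.
  rewrite mcoeff_walk0; case: (m =P 0%MM) => [->|_]; last by rewrite eqxx.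
  case: (v =P r) => [->|_]; last by rewrite eqxx.
  rewrite mdeg0 eqxx => _; apply/forallP => u.
  by rewrite outdeg0 indeg0.
rewrite mcoeff_walkS => nz.
have [w m_vw /IHN/andP[dm bm]] : exists2 w, (0 < m (x v w))%N &
    ((X ^+ N) w r)@_(m - U_(x v w)) != 0.
  apply/exists_inP; apply: contraR nz => /exists_inPn h.
  by rewrite big1 // => w /h /negPn/eqP.
have mE : m = (m - U_(x v w) + U_(x v w))%MM by rewrite submK // lep1mP -lt0n.
by rewrite mE mdegD mdeg1 balanced_step bm addn1 eqSS dm.
Qed.

(* I - D^-1 A, where A is the matrix of [m] and D its diagonal of outdegrees, with
   row [r] replaced by that of I.  Since x / 0 = 0, the row of a vertex without
   outgoing arc is also that of I. *)
Definition laplacian m r : 'M[F]_n :=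
  \matrix_(u, w) ((u == w)%:R
                  - (u != r)%:R * ((m (x u w))%:R / (outdeg m u)%:R)).

(** * Arc removal and the BEST theorem *)

Lemma outdegB v w m : (0 < m (x v w))%N ->
  outdeg m =1 (fun u => outdeg (m - U_(x v w))%MM u + (u == v))%N.
Proof.
move=> m_vw u; rewrite -(outdegU v w) -outdegD submK //.
by rewrite lep1mP -lt0n.
Qed.

Lemma leq_outdeg m u w : (m (x u w) <= outdeg m u)%N.
Proof. by rewrite /outdeg (bigD1 w) //= leq_addr. Qed.

Lemma leq_indeg m u w : (m (x u w) <= indeg m w)%N.
Proof. by rewrite /indeg (bigD1 u) //= leq_addr. Qed.

Lemma cofactor_eq_row (A B : 'M[F]_n) v j :
  (forall u w, u != v -> A u w = B u w) -> cofactor A v j = cofactor B v j.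
Proof.
move=> eqAB; rewrite /cofactor; congr (_ * \det _).
by apply/matrixP => i i'; rewrite !mxE eqAB // eq_sym neq_lift.
Qed.

Lemma laplacian_cofactorB m r v w j : (0 < m (x v w))%N ->
  cofactor (laplacian (m - U_(x v w))%MM r) v j = cofactor (laplacian m r) v j.
Proof.
move=> m_vw; apply: cofactor_eq_row => u u' /negbTE ne_uv.
rewrite !mxE mnmBE mnm1E mxvec_index_inj [v == u]eq_sym ne_uv subn0.
by rewrite (outdegB m_vw u) ne_uv addn0.
Qed.

(** Arcs out of the root could only affect row [r], which is fixed to that of the identity. *)
Lemma det_laplacianB_root m r w : (0 < m (x r w))%N ->
  \det (laplacian (m - U_(x r w))%MM r) = \det (laplacian m r).
Proof.
move=> m_rw; rewrite !(expand_det_row _ r); apply: eq_bigr => j _.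
by rewrite laplacian_cofactorB // !mxE eqxx !mul0r.
Qed.

(* Removing an arc out of [v] only changes row [v], in which the determinant is
   linear. *)
Lemma sum_det_laplacianB m r v : v != r -> balanced v r m ->
  \sum_(w | (0 < m (x v w))%N)
     (m (x v w))%:R * \det (laplacian (m - U_(x v w))%MM r)
  = (outdeg m v)%:R * \det (laplacian m r).
Proof.
move=> ne_vr bal; pose c j := cofactor (laplacian m r) v j.
pose d : F := (outdeg m v)%:R.
have dE : d = \sum_w (m (x v w))%:R by rewrite -natr_sum.
have dv : outdeg m v = (indeg m v).+1.
  by have /forallP/(_ v)/eqP := bal; rewrite eqxx (negbTE ne_vr); lia.
have d_neq0 : d != 0 by rewrite /d dv pnatr_eq0.
(* Without the arc from [v] to [w], the outdegree of [v] is [d - 1]; for [d = 1] the division below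
   is by 0 and yields 0. *)
have detB w : (0 < m (x v w))%N -> \det (laplacian (m - U_(x v w))%MM r) =
    \sum_j ((v == j)%:R - ((m (x v j))%:R - (w == j)%:R) / (d - 1)) * c j.
  move=> m_vw; rewrite (expand_det_row _ v); apply: eq_bigr => j _.
  rewrite laplacian_cofactorB // !mxE ne_vr mul1r mnmBE mnm1E mxvec_index_inj eqxx /=.
  rewrite natrB; last by case: eqP => // <-.
  by rewrite /d (outdegB m_vw v) eqxx natrD addrK.
rewrite (eq_bigr _ (fun w h => congr1 _ (detB w h))).
have -> : \sum_(w | (0 < m (x v w))%N) (m (x v w))%:R *
      \sum_j ((v == j)%:R - ((m (x v j))%:R - (w == j)%:R) / (d - 1)) * c j
   = \sum_j (d * (v == j)%:R - (d - 1) * (m (x v j))%:R / (d - 1)) * c j.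
  rewrite big_mkcond /=.
  under eq_bigr => w _.
    rewrite (_ : (if _ then _ else _) = \sum_j (m (x v w))%:R *
       (((v == j)%:R - ((m (x v j))%:R - (w == j)%:R) / (d - 1)) * c j)); last first.
      case: posnP => [->|_]; last by rewrite mulr_sumr.
      by rewrite big1 // => j _; rewrite mul0r.
    over.
  rewrite exchange_big; apply: eq_bigr => j _ /=.
  under eq_bigr do rewrite mulrA.
  rewrite -mulr_suml; congr (_ * _).
  transitivity (\sum_w (m (x v w))%:R * ((v == j)%:R - (m (x v j))%:R / (d - 1))
     + \sum_w (m (x v w))%:R * (w == j)%:R / (d - 1)).
    by rewrite -big_split /=; apply: eq_bigr => w _; ring.
  rewrite -!mulr_suml -dE (bigD1 j) //= eqxx big1 => [|w /negbTE->]; last first.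
    by rewrite mulr0.
  by rewrite mulr1; ring.
rewrite (expand_det_row _ v) mulr_sumr.
(* For [d] other than 1 the factor [d - 1] cancels in every entry, leaving row [v] scaled by [d]. *)
have [d1|d1] := eqVneq d 1; last first.
  have d1' : d - 1 != 0 by rewrite subr_eq0.
  apply: eq_bigr => j _; rewrite !mxE ne_vr mul1r -/d -/(c j); field.
  by rewrite d_neq0.
(* When the only arc out of [v] is removed, row [v] changes by a vector on
   which the cofactors vanish, as no arc enters [v]. *)
have inv0 : indeg m v = 0%N.
  by apply/eqP; rewrite -eqSS -dv -(eqr_nat F); apply/eqP.
suff c0 : \sum_j (m (x v j))%:R * c j = 0.
  rewrite d1 -[RHS]addr0 -[X in _ = _ + X]c0 -big_split /=; apply: eq_bigr => j _.
  by rewrite !mxE ne_vr !mul1r -/d d1 -/(c j) divr1; ring.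
(* [B] is the Laplacian with row [v] replaced by the multiplicities of the arcs out of [v]; its
   column [v] is zero since the indegree of [v] is 0. *)
pose B : 'M[F]_n := \matrix_(u, w) if u == v then (m (x v w))%:R else laplacian m r u w.
have -> : \sum_j (m (x v j))%:R * c j = \det B.
  rewrite (expand_det_row _ v); apply: eq_bigr => j _; rewrite mxE eqxx.
  congr (_ * _); apply: cofactor_eq_row => u w /negbTE ne_uv.
  by rewrite [RHS]mxE ne_uv.
rewrite (expand_det_col _ v) big1 // => u _.
have m_uv : m (x u v) = 0%N by apply/eqP; rewrite -leqn0 -inv0 leq_indeg.
rewrite mxE; case: eqVneq m_uv => [->|ne] m_uv; first by rewrite m_uv mul0r.
by rewrite mxE m_uv (negbTE ne) mul0r mulr0 subr0 mul0r.
Qed.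

(* The indicator of the vertices of nonzero outdegree is in the kernel. *)
Lemma det_laplacian_isolated_root m r u :
  balanced r r m -> outdeg m r = 0%N -> (0 < outdeg m u)%N -> \det (laplacian m r) = 0.
Proof.
move=> /balanced_closed bal dr du; apply/eqP; rewrite -det_tr; apply/det0P.
exists (\row_w (0 < outdeg m w)%N%:R).
  by apply/eqP => /rowP/(_ u)/eqP; rewrite !mxE du oner_eq0.
apply/rowP => w; rewrite !mxE.
under eq_bigr => j _ do rewrite !mxE mulrBr.
rewrite big_split /= (bigD1 w) //= eqxx mulr1 big1 => [|j /negbTE ne]; last first.
  by rewrite eq_sym ne mulr0.
rewrite addr0 sumrN.
have [w0|w_gt0] := posnP (outdeg m w).
  rewrite big1 ?subr0 // => j _.
  by rewrite w0 invr0 !mulr0.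
have ne_wr : w != r by apply: contraTneq w_gt0 => ->; rewrite dr.
rewrite (eq_bigr (fun j => (m (x w j))%:R / (outdeg m w)%:R)) => [|j _]; last first.
  rewrite ne_wr mul1r; have [j0|_] := posnP (outdeg m j); last by rewrite mul1r.
  have /eqP-> : m (x w j) == 0%N by rewrite -leqn0 -j0 bal leq_indeg.
  by rewrite !mul0r.
by rewrite -mulr_suml -natr_sum divff ?subrr // pnatr_eq0 -lt0n.
Qed.

(* The BEST theorem, by removing the first arc of the walk. *)
Theorem mcoeff_walk N v r m : mdeg m = N -> balanced v r m ->
  (mfact m)%:R * ((X ^+ N) v r)@_m =
  (\prod_u (outdeg m u)`!)%:R * \det (laplacian m r).
Proof.
elim: N v m => [|N IHN] v m.
  move/eqP; rewrite mdeg_eq0 => /eqP-> /forallP/(_ v)/eqP.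
  rewrite outdeg0 indeg0 eqxx; case: eqVneq => // ev _; rewrite mcoeff_walk0 ev !eqxx mulr1.
  have -> : laplacian 0%MM r = 1%:M.
    by apply/matrixP => u w; rewrite !mxE mnm0E mul0r mulr0 subr0.
  rewrite det1 mulr1 /mfact !big1 // => u _; last by rewrite mnm0E.
  by rewrite outdeg0.
move=> dm bal; rewrite mcoeff_walkS mulr_sumr.
pose p : F := (\prod_(u | u != v) (outdeg m u)`!)%:R.
(* Removing the arc lowers only the outdegree of [v], so the outdegree factorials split as [p] times
   a factor for [v]; [mfactU] supplies the multiplicity. *)
have term w : (0 < m (x v w))%N ->
    (mfact m)%:R * ((X ^+ N) w r)@_(m - U_(x v w)) =
    p * (outdeg m v).-1`!%:R * ((m (x v w))%:R * \det (laplacian (m - U_(x v w))%MM r)).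
  move=> m_vw; have mE : (m - U_(x v w) + U_(x v w))%MM = m.
    by rewrite submK // lep1mP -lt0n.
  rewrite -{1}mE mfactU natrM mulrAC -mulrA [X in _ * X]mulrC IHN; first last.
  - by rewrite -(balanced_step v) mE.
  - by apply/eqP; rewrite -eqSS -dm -{2}mE mdegD mdeg1 addn1.
  rewrite mnmBE mnm1E eqxx subn1 prednK //.
  suff -> : (\prod_u (outdeg (m - U_(x v w))%MM u)`!)%:R =
      p * (outdeg m v).-1`!%:R :> F by rewrite mulrCA.
  rewrite (bigD1 v) //= mulnC natrM; congr (_%:R * _%:R).
    apply: eq_bigr => u /negbTE ne.
    by rewrite (outdegB m_vw u) ne addn0.
  by rewrite (outdegB m_vw v) eqxx addn1.
rewrite (eq_bigr _ term) -mulr_sumr {term}.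
have [v0|v_gt0] := posnP (outdeg m v); last first.
  suff -> : \sum_(w | (0 < m (x v w))%N)
      (m (x v w))%:R * \det (laplacian (m - U_(x v w))%MM r) =
    (outdeg m v)%:R * \det (laplacian m r).
    rewrite mulrA; congr (_ * _); rewrite -mulrA -natrM -[X in (X%:R)]mulnC.
    rewrite -(prednK v_gt0) -factS prednK // (bigD1 v) //= natrM mulrC.
    by [].
  have [ev|ne] := eqVneq v r; last exact: sum_det_laplacianB.
  rewrite -ev in bal *.
  under eq_bigr => w m_vw do rewrite det_laplacianB_root //.
  rewrite -mulr_suml natr_sum; congr (_ * _).
  rewrite [RHS](bigID (fun w => 0 < m (x v w))%N) /= [X in _ + X]big1 ?addr0 //.
  by move=> w; rewrite -eqn0Ngt => /eqP->.
(* No arc leaves [v], so balance forces [v = r]. Arcs remain but none can be taken first: the left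
   side is an empty sum, and the determinant vanishes as well. *)
have ev : v = r.
  have /forallP/(_ v)/eqP := bal; rewrite v0 eqxx.
  by case: (v =P r) => //; lia.
rewrite [X in _ * X]big1 => [|w]; last first.
  by have := leq_outdeg m v w; rewrite v0 leqn0 => /eqP->.
rewrite mulr0; symmetry; rewrite ev in bal v0.
have [u du] : exists u, (0 < outdeg m u)%N.
  apply/existsP; move/eqP: dm; apply: contraTT; rewrite negb_exists => /forallP h.
  by rewrite mdeg_outdeg big1 // => u _; apply/eqP; rewrite eqn0Ngt h.
by rewrite (det_laplacian_isolated_root bal v0 du) mulr0.
Qed.

End Walks.

(** Eliminating either off-diagonal block of [M] gives two block triangular factorizations, whose
    determinants agree. *)
Lemma det_1Bmul (R : comNzRingType) n (a : 'cV[R]_n) (b : 'rV[R]_n) :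
  \det (1%:M - a *m b) = 1 - (b *m a) 0 0.
Proof.
pose M : 'M[R]_(1 + n) := block_mx 1%:M b a 1%:M.
have e1 : M = block_mx 1%:M 0 a 1%:M *m block_mx 1%:M b 0 (1%:M - a *m b).
  by rewrite mulmx_block !mulmx1 !mul1mx !mulmx0 !mul0mx !addr0 addrC subrK.
have e2 : M = block_mx 1%:M b 0 1%:M *m block_mx (1%:M - b *m a) 0 a 1%:M.
  by rewrite mulmx_block !mulmx1 !mul1mx !mulmx0 !mul0mx !add0r subrK.
have := congr1 determinant e1; rewrite {1}e2 !det_mulmx.
rewrite !det_lblock !det_ublock !det1 !mul1r !mulr1 => <-.
by rewrite det_mx11 !mxE.
Qed.

(** * Eulerian walks in a complete digraph *)

Section CompleteDigraph.
Variables (F : numFieldType) (n : nat).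
Local Notation x u w := (mxvec_index u w).

Definition out_arcs (u : 'I_n) (e : {set 'I_n}) : 'X_{1..n * n} :=
  (\sum_(w in e :\ u) U_(x u w))%MM.

Definition complete_digraph (e : {set 'I_n}) : 'X_{1..n * n} :=
  (\sum_(u in e) out_arcs u e)%MM.

Lemma out_arcsE u e v w : out_arcs u e (x v w) = (v == u) && (w \in e :\ u) :> nat.
Proof.
rewrite /out_arcs mnm_sumE.
under eq_bigr => w' _ do rewrite mnm1E mxvec_index_inj eq_sym.
case: (v == u); last by rewrite big1.
have [we|we] := boolP (w \in e :\ u).
  rewrite (bigD1 w) //= eqxx big1 // => w' /andP[_ /negbTE] ->//.
by rewrite big1 // => w' we'; case: eqP => // ew; rewrite -ew we' in we.
Qed.

Lemma complete_digraphE e v w :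
  complete_digraph e (x v w) = [&& v \in e, w \in e & v != w] :> nat.
Proof.
rewrite mnm_sumE; under eq_bigr => u _ do rewrite out_arcsE.
have [ve|ve] := boolP (v \in e); last first.
  by rewrite big1 // => u ue; case: eqP => // evu; rewrite evu ue in ve.
rewrite (bigD1 v) //= eqxx big1 => [|u /andP[_ /negbTE]]; last by rewrite eq_sym => ->.
by rewrite addn0 /= !inE andbC [v == w]eq_sym.
Qed.

Lemma outdeg_out_arcs u e v :
  outdeg (out_arcs u e) v = ((v == u) * #|e :\ u|)%N.
Proof.
rewrite /outdeg; under eq_bigr do rewrite out_arcsE.
case: (v == u); last by rewrite big1.
by rewrite -sum1_card mul1n [RHS]big_mkcond /=; apply: eq_bigr => w _; case: ifP.
Qed.

Lemma indeg_out_arcs u e v : indeg (out_arcs u e) v = (v \in e :\ u).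
Proof.
rewrite /indeg (bigD1 u) //= out_arcsE eqxx big1 ?addn0 // => w /negbTE ne.
by rewrite out_arcsE ne.
Qed.

Lemma outdeg_complete e u :
  outdeg (complete_digraph e) u = ((u \in e) * #|e|.-1)%N.
Proof.
rewrite /outdeg; under eq_bigr do rewrite complete_digraphE.
have [ue|_] := boolP (u \in e); last by rewrite big1.
rewrite mul1n (cardsD1 u) ue -sum1_card [RHS]big_mkcond /=.
by apply: eq_bigr => w _; rewrite !inE andbC [w == u]eq_sym; case: ifP.
Qed.

Lemma indeg_complete e u : indeg (complete_digraph e) u = outdeg (complete_digraph e) u.
Proof.
rewrite /indeg /outdeg; apply: eq_bigr => w _.
by rewrite !complete_digraphE andbCA eq_sym.
Qed.

Lemma mdeg_complete e : mdeg (complete_digraph e) = (#|e| * #|e|.-1)%N.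
Proof.
rewrite mdeg_outdeg; under eq_bigr do rewrite outdeg_complete.
rewrite -big_distrl /=; congr (_ * _)%N; rewrite -sum1_card [RHS]big_mkcond /=.
by apply: eq_bigr => u _; case: ifP.
Qed.

Lemma balanced_complete e r : balanced r r (complete_digraph e).
Proof. by apply/forallP => u; rewrite indeg_complete. Qed.

Lemma mfact_complete e : mfact (complete_digraph e) = 1%N.
Proof.
rewrite /mfact big1 // => i _.
by case/mxvec_indexP: i => v w; rewrite complete_digraphE; case: (_ && _).
Qed.

(** Once a diagonal factor is taken out, the matrix is a rank-one perturbation of the identity and
    [det_1Bmul] applies. The factor [1 - #|e :\ r| / #|e|] is [1 / #|e|] for [r] in [e] and 0
    otherwise. The power of [#|e|] is Cayley's number of trees. *)
Lemma det_laplacian_complete (e : {set 'I_n}) r : (1 < #|e|)%N ->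
  \det (laplacian F (complete_digraph e) r) =
  (r \in e)%:R * #|e|%:R ^+ (#|e| - 2) / #|e|.-1%:R ^+ #|e|.-1.
Proof.
move=> e_gt1; pose k : F := #|e|%:R; pose k1 : F := #|e|.-1%:R.
have k_neq0 : k != 0 by rewrite pnatr_eq0; lia.
have k1_neq0 : k1 != 0 by rewrite pnatr_eq0; lia.
have kE : k = k1 + 1 by rewrite /k -(prednK (ltnW e_gt1)) natr1.
pose a : 'cV[F]_n := \col_u (u \in e :\ r)%:R.
pose b : 'rV[F]_n := \row_u ((u \in e)%:R / k).
pose c : 'rV[F]_n := \row_u (if u \in e :\ r then k / k1 else 1).
have -> : laplacian F (complete_digraph e) r = diag_mx c *m (1%:M - a *m b).
  rewrite mul_diag_mx; apply/matrixP => u w.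
  rewrite !mxE big_ord1 !mxE outdeg_complete complete_digraphE !inE.
  have [->|ne_ur] := eqVneq u r; first by rewrite /= !mul0r mul1r.
  have [ue|ue] := boolP (u \in e); last by rewrite /= !mul0r mulr0 !mul1r.
  rewrite /= !mul1n -/k1 mul1r mul1r.
  case: eqVneq => [<-|ne_uw]; last first.
    by case: (w \in e) => /=; rewrite ?andbT ?andbF; field; rewrite ?k_neq0 ?k1_neq0.
  by rewrite ue /= kE; field; rewrite -kE k_neq0 k1_neq0.
rewrite det_mulmx det_diag det_1Bmul.
have -> : (b *m a) 0 0 = #|e :\ r|%:R / k.
  rewrite mxE -sum1_card natr_sum mulr_suml [RHS]big_mkcond /=; apply: eq_bigr => u _.
  rewrite !mxE; case: ifP => ue; last by rewrite mulr0.
  by move: ue; rewrite !inE => /andP[_ ->]; rewrite mulr1.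
have -> : \prod_i c 0 i = (k / k1) ^+ #|e :\ r|.
  rewrite -prodr_const [RHS]big_mkcond /=; apply: eq_bigr => u _.
  by rewrite mxE.
have := cardsD1 r e; have [re|re] := boolP (r \in e) => /= cE; last first.
  by rewrite -[#|_ :\ _|]add0n -cE divff // subrr mulr0 !mul0r.
have -> : #|e :\ r| = #|e|.-1 by rewrite cE.
rewrite -/k1 expr_div_n mul1r.
rewrite -/k {1}(_ : #|e|.-1 = (#|e| - 2).+1) ?exprS; last by lia.
rewrite kE; field; rewrite -kE k_neq0 expf_neq0 //.
Qed.

(** The BEST theorem is applied at each starting vertex. The [#|e|] vertices of [e] contribute
    equally and the others nothing, which raises the exponent from [#|e| - 2] to [#|e|.-1]. *)
Lemma mcoeff_tr_complete (e : {set 'I_n}) : (1 < #|e|)%N ->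
  (\tr (generic_mx F n ^+ (#|e| * #|e|.-1)))@_(complete_digraph e) =
  (#|e|.-1)`!%:R ^+ #|e| * #|e|%:R ^+ #|e|.-1 / #|e|.-1%:R ^+ #|e|.-1.
Proof.
move=> e_gt1; rewrite /mxtrace raddf_sum /=.
transitivity (\sum_(r : 'I_n) (#|e|.-1)`!%:R ^+ #|e| *
  ((r \in e)%:R * #|e|%:R ^+ (#|e| - 2) / #|e|.-1%:R ^+ #|e|.-1) : F).
  apply: eq_bigr => r _.
  have := mcoeff_walk F (mdeg_complete e) (balanced_complete e r).
  rewrite mfact_complete mul1r det_laplacian_complete // => ->; congr (_ * _).
  rewrite natr_prod -prodr_const [RHS]big_mkcond; apply: eq_bigr => u _.
  by rewrite outdeg_complete; case: ifP => _; rewrite ?mul1n ?mul0n.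
rewrite -mulr_sumr -!mulrA; congr (_ * _); rewrite -!mulr_suml -natr_sum.
have -> : (\sum_(r : 'I_n) (r \in e) = #|e|)%N.
  by rewrite -sum1_card [RHS]big_mkcond; apply: eq_bigr => r _; case: ifP.
rewrite -exprS; congr (_ ^+ _ / _); by case: #|e| e_gt1 => [|[|c]] // _; rewrite subn2.
Qed.

End CompleteDigraph.

(** * Expansion over choices of rooted edges *)

Section AdjacencyTrace.
Variables (F : numFieldType) (n k : nat) (H : hypergraph k 'I_n).
Hypothesis k_gt1 : (1 < k)%N.
Implicit Types (i u : 'I_n) (f e : {set 'I_n}) (rs : seq 'I_n).
Implicit Types (phi : seq {set 'I_n}).

Local Notation x u w := (mxvec_index u w).
Local Notation P := {mpoly F[n * n]}.
Local Notation X := (generic_mx F n).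
Local Notation D := (tensor_op (adjacency_tensor F H)).
Implicit Types (p : P).

Lemma pderivE i (l : seq 'I_n) p :
  pderiv i l p = p^`M[\sum_(a <- l) U_(x i a)%MM].
Proof.
elim: l => [|a l IHl] /=; first by rewrite big_nil mderivm0m.
by rewrite big_cons addmC mderivmDm mderivmU1m IHl.
Qed.

Lemma card_edgeD1 f i : f \in edges H -> i \in f -> #|f :\ i| = k.-1.
Proof. by move=> /edges_card fE fi; rewrite -fE (cardsD1 i f) fi. Qed.

Lemma edge_cons_tuple f i (l : k.-1.-tuple 'I_n) :
  f \in edges H -> i \in f ->
  ([set a in i :: l] == f) = all (fun a => a \in f :\ i) l && uniq l.
Proof.
move=> fE fi; have cf := edges_card fE.
apply/eqP/andP => [lE|[/allP lf ul]].
  have ul : uniq (i :: l).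
    by apply/card_uniqP; rewrite -cardsE lE cf /= size_tuple prednK // ltnW.
  move: (ul) => /= /andP[il ->]; split=> //; apply/allP => a al.
  by rewrite !inE -lE !inE al orbT andbT; apply: contraNneq il => <-.
apply/eqP; rewrite eqEcard; apply/andP; split.
  by apply/subsetP => a; rewrite !inE => /predU1P[->//|/lf]; rewrite !inE => /andP[].
rewrite cf cardsE (card_uniqP _) /= ?size_tuple ?prednK ?(ltnW k_gt1) // ul andbT.
by apply/negP => /lf; rewrite !inE eqxx.
Qed.

(** All orderings of [f :\ i] give the same derivative, and their number cancels the weight of the
    adjacency tensor. *)
Lemma tensor_op_adjacency i p :
  D i p = \sum_(f in [set f in edges H | i \in f]) p^`M[out_arcs i f].
Proof.
rewrite /tensor_op /adjacency_tensor.
transitivity (\sum_(l : k.-1.-tuple 'I_n | [set a in i :: l] \in edges H)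
                (k.-1)`!%:R^-1 *: pderiv i l p).
  by rewrite [RHS]big_mkcond; apply: eq_bigr => l _; case: ifP; rewrite ?scale0r.
rewrite (partition_big (fun l : k.-1.-tuple 'I_n => [set a in i :: l])
           (mem [set f in edges H | i \in f])) /=; last first.
  by move=> l lE; rewrite !inE lE eqxx.
apply: eq_bigr => f; rewrite inE => /andP[fE fi].
rewrite (eq_bigl (fun l : k.-1.-tuple 'I_n =>
                    l \in [set t : k.-1.-tuple 'I_n | all (fun a => a \in f :\ i) t & uniq t])).
  rewrite (eq_bigr (fun=> (k.-1)`!%:R^-1 *: p^`M[out_arcs i f])) => [|l].
    rewrite sumr_const card_uniq_tuples card_edgeD1 // ffactnn.
    rewrite -scaler_nat scalerA divff ?scale1r //.
    by rewrite pnatr_eq0 -lt0n fact_gt0.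
  rewrite inE => /andP[/allP lf ul]; rewrite pderivE; congr (_ *: mderivm _ _).
  rewrite /out_arcs -big_enum /=; apply: perm_big; apply: uniq_perm => //.
    exact: enum_uniq.
  have [] := uniq_min_size ul (s2 := enum (f :\ i)) => //.
    by move=> a /lf; rewrite mem_enum.
  by rewrite -cardE card_edgeD1 // size_tuple.
move=> l; rewrite inE -edge_cons_tuple //.
by case: eqP => [->|]; rewrite ?fE ?andbF.
Qed.

(** Lists of edges, not sets: a root repeated in [rs] chooses its edge anew each time. *)
Fixpoint edge_choices rs : seq (seq {set 'I_n}) :=
  if rs is i :: rs' then
    [seq f :: phi | f <- enum [set f in edges H | i \in f],
                    phi <- edge_choices rs']
  else [:: [::]].

Definition choice_arcs rs phi : 'X_{1..n * n} :=
  (\sum_(c <- zip rs phi) out_arcs c.1 c.2)%MM.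

Lemma foldr_tensor_op rs p :
  foldr D p rs = \sum_(phi <- edge_choices rs) p^`M[choice_arcs rs phi].
Proof.
elim: rs => [|i rs IHrs] /=.
  by rewrite big_seq1 /choice_arcs big_nil mderivm0m.
rewrite big_allpairs_dep IHrs tensor_op_adjacency -big_enum /=.
apply: eq_bigr => f _; rewrite raddf_sum; apply: eq_bigr => phi _ /=.
by rewrite /choice_arcs /= big_cons addmC mderivmDm.
Qed.

Lemma edge_choices_uniq rs : uniq (edge_choices rs).
Proof.
elim: rs => //= i rs IHrs; apply: allpairs_uniq => //; first exact: enum_uniq.
by move=> [f phi] [f' phi'] _ _ [-> ->].
Qed.

Lemma nseq_edge_choices rs e :
  e \in edges H -> {subset rs <= e} -> nseq (size rs) e \in edge_choices rs.
Proof.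
move=> eE; elim: rs => //= i rs IHrs sub; apply: allpairs_f.
  by rewrite mem_enum inE eE sub ?mem_head.
by apply: IHrs => a ars; rewrite sub // inE ars orbT.
Qed.

(** An edge rooted at [i] has [k.-1] arcs out of [i] and one into each other vertex; adding one at
    the root turns the indegree into a count of the chosen edges through [u]. *)
Lemma edge_choicesP rs phi : phi \in edge_choices rs ->
  [/\ size phi = size rs, {subset phi <= edges H},
      forall u, outdeg (choice_arcs rs phi) u = (count_mem u rs * k.-1)%N
    & forall u, (indeg (choice_arcs rs phi) u + count_mem u rs)%N
              = count (fun f => u \in f) phi].
Proof.
elim: rs phi => [|i rs IHrs] phi /=.
  rewrite inE => /eqP->; split=> // u; rewrite /choice_arcs big_nil.
    by rewrite outdeg0.
  by rewrite indeg0.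
case/allpairsP => [[f phi']] [/= fE /IHrs[sz sub dout din] ->] /=.
move: fE; rewrite mem_enum inE => /andP[fE fi].
split; first by rewrite sz.
- by move=> g; rewrite inE => /predU1P[->//|/sub].
- move=> u; rewrite /choice_arcs /= big_cons outdegD outdeg_out_arcs /= dout.
  by rewrite card_edgeD1 // mulnDl [u == i]eq_sym.
- move=> u; rewrite /choice_arcs /= big_cons indegD indeg_out_arcs /= -din.
  rewrite addnACA; congr (_ + _)%N; rewrite !inE eq_sym.
  by case: eqVneq => [<-|_]; rewrite ?fi ?addn0.
Qed.

Lemma mdeg_choice_arcs rs phi :
  phi \in edge_choices rs -> mdeg (choice_arcs rs phi) = (size rs * k.-1)%N.
Proof.
move=> /edge_choicesP[_ _ dout _]; rewrite mdeg_outdeg.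
rewrite (eq_bigr _ (fun u _ => dout u)) -big_distrl /=; congr (_ * _)%N.
elim: rs {dout} => [|i rs IHrs] /=; first by rewrite big1.
by rewrite big_split /= IHrs (bigD1 i) //= eqxx big1 // => u /negbTE; rewrite eq_sym => ->.
Qed.

(* Balance at [u] says that the number of chosen edges containing [u] is [k]
   times the number of chosen edges rooted at [u]; as only [k] edges are chosen,
   every root lies in all of them. *)
Lemma choice_arcs_balanced rs phi r :
  size rs = k -> phi \in edge_choices rs -> balanced r r (choice_arcs rs phi) ->
  [/\ uniq rs, [set a in rs] \in edges H & phi = nseq k [set a in rs]].
Proof.
move=> sz_rs /edge_choicesP[sz_phi phiE dout din] /balanced_closed bal.
have k_gt0 : (0 < k)%N by apply: ltnW.
have cnt u : count (fun f => u \in f) phi = (count_mem u rs * k)%N.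
  by rewrite -din -bal dout -mulnSr prednK.
have le_k u : (count_mem u rs * k <= k)%N by rewrite -cnt -sz_rs -sz_phi count_size.
have cnt1 u : count_mem u rs = (u \in rs).
  apply/eqP; rewrite -has_pred1 has_count; have := le_k u.
  by rewrite -{2}[k]mul1n leq_pmul2r //; case: (count_mem u rs) => [|[|]].
have urs : uniq rs by apply: count_mem_uniq.
have sub f : f \in phi -> [set a in rs] = f.
  move=> f_phi; apply/eqP; rewrite eqEcard cardsE (card_uniqP urs) sz_rs.
  rewrite (edges_card (phiE f f_phi)) leqnn andbT; apply/subsetP => a.
  rewrite inE => a_rs; suff /allP : all (fun f => a \in f) phi by apply.
  by rewrite all_count cnt cnt1 a_rs mul1n sz_phi sz_rs.
have phi_nseq : phi = nseq k [set a in rs].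
  rewrite -sz_rs -sz_phi; apply/all_pred1P/allP => f /sub ->; exact: eqxx.
split=> //; apply: phiE; rewrite phi_nseq mem_nseq k_gt0 eqxx //.
Qed.

(** The trace is homogeneous of degree [N], so a derivative of that order leaves only the
    coefficient of [m], times the factorials of its exponents. *)
Lemma mderivm_tr N (m : 'X_{1..n * n}) : mdeg m = N ->
  (\tr (X ^+ N))^`M[m] = ((mfact m)%:R * (\tr (X ^+ N))@_m)%:MP.
Proof.
move=> dm; apply/mpolyP => m'; rewrite mcoeff_mderivm mcoeffC.
have [->|m'0] := eqVneq m' 0%MM.
  rewrite addm0 mulr1 -[LHS]mulr_natl; congr (_%:R * _).
  by apply: eq_bigr => i _; rewrite ffactnn.
rewrite mulr0 /mxtrace raddf_sum /= big1 ?mul0rn // => r _.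
apply/eqP; apply: contraT => /mcoeff_walk_neq0/andP[/eqP].
by rewrite mdegD dm => /eqP; rewrite -{2}[N]addn0 eqn_add2l mdeg_eq0 (negbTE m'0).
Qed.

Lemma choice_arcs_nseq rs :
  uniq rs -> choice_arcs rs (nseq (size rs) [set a in rs]) =
             complete_digraph [set a in rs].
Proof.
move=> urs; have rootsE e : choice_arcs rs (nseq (size rs) e) =
    (\sum_(i <- rs) out_arcs i e)%MM.
  rewrite /choice_arcs; elim: rs {urs} => [|i rs IHrs] /=.
    by rewrite !big_nil.
  by rewrite !big_cons IHrs.
rewrite rootsE /complete_digraph big_uniq //=; apply: eq_bigl => i; by rewrite inE.
Qed.

(** By [choice_arcs_balanced] the constant choice of the set of roots is the only one that can
    contribute, and its arcs form a complete digraph. *)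
Lemma foldr_tensor_op_tr rs : size rs = k ->
  foldr D (\tr (X ^+ (k * k.-1))) rs =
  if uniq rs && ([set a in rs] \in edges H) then
    ((k.-1)`!%:R ^+ k * k%:R ^+ k.-1 / k.-1%:R ^+ k.-1)%:MP
  else 0.
Proof.
move=> sz_rs; rewrite foldr_tensor_op.
have term0 phi : phi \in edge_choices rs ->
    ~~ [&& uniq rs, [set a in rs] \in edges H & phi == nseq k [set a in rs]] ->
    (\tr (X ^+ (k * k.-1)))^`M[choice_arcs rs phi] = 0.
  move=> phi_in nphi; rewrite mderivm_tr; last by rewrite mdeg_choice_arcs // sz_rs.
  rewrite /mxtrace raddf_sum /= big1 ?mulr0 ?mpolyC0 // => r _.
  apply/eqP; apply: contraNT nphi => /mcoeff_walk_neq0/andP[_].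
  by case/choice_arcs_balanced => // -> -> /eqP.
case: ifP => [/andP[urs eE]|nrs]; last first.
  rewrite big_seq big1 // => phi phi_in.
  by apply: term0 => //; rewrite andbA nrs.
have sub : {subset rs <= [set a in rs]} by move=> a; rewrite inE.
rewrite (bigD1_seq _ (nseq_edge_choices eE sub) (edge_choices_uniq rs)) /=.
rewrite big_seq_cond big1 ?addr0 => [|phi /andP[phi_in ne]]; last first.
  by apply: term0 => //; rewrite -[X in nseq X]sz_rs (negbTE ne) !andbF.
rewrite choice_arcs_nseq //; have ce := edges_card eE.
rewrite mderivm_tr; last by rewrite mdeg_complete ce.
have := @mcoeff_tr_complete F n [set a in rs]; rewrite ce => -> //.
by rewrite mfact_complete mul1r.
Qed.

(** * Exponent vectors and the trace of a uniform hypergraph *)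

Lemma tensor_opZ i (c : F) p : D i (c *: p) = c *: D i p.
Proof.
rewrite !tensor_op_adjacency scaler_sumr.
by apply: eq_bigr => f _; rewrite mderivmZ.
Qed.

(** Scalars pass through the operators, so the composition becomes one fold over the list in which
    [i] is repeated [d i] times. *)
Lemma big_comp_tensor_op (s : seq 'I_n) (c : 'I_n -> F) (d : 'I_n -> nat) p :
  (\big[@comp P P P / @id P]_(i <- s) (fun q => c i *: iter (d i) (D i) q)) p =
  (\prod_(i <- s) c i) *: foldr D p (flatten [seq nseq (d i) i | i <- s]).
Proof.
elim: s => [|i s IHs] /=; first by rewrite !big_nil scale1r.
rewrite !big_cons /= IHs foldr_cat -scalerA; congr (_ *: _).
by elim: (d i) => //= j ->; rewrite tensor_opZ.
Qed.

(** The exponent vector that uses each vertex of [e] once as a root; no other kind survives in the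
    trace. *)
Definition edge_ffun e : {ffun 'I_n -> 'I_k.+1} := [ffun i => inord (i \in e)].

Lemma edge_ffunE e i : edge_ffun e i = (i \in e) :> nat.
Proof. by rewrite ffunE inordK // ltnS; case: (i \in e); rewrite // ltnW. Qed.

Lemma edge_ffun_inj : injective edge_ffun.
Proof.
move=> e e' eq; apply/setP => i.
by move/ffunP/(_ i)/(congr1 val): eq; rewrite /= !edge_ffunE; do 2 case: (i \in _).
Qed.

Let roots (d : {ffun 'I_n -> 'I_k.+1}) : seq 'I_n :=
  flatten [seq nseq (d i) i | i <- index_enum 'I_n].

Lemma count_roots d i : count_mem i (roots d) = d i.
Proof.
rewrite count_flatten sumnE !big_map (bigD1 i) //= count_nseq /= eqxx mul1n.
by rewrite big1 ?addn0 // => j /negbTE ne; rewrite count_nseq /= ne.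
Qed.

Lemma size_roots d : size (roots d) = (\sum_i d i)%N.
Proof.
rewrite size_flatten sumnE !big_map.
by apply: eq_bigr => i _; rewrite size_nseq.
Qed.

Lemma mem_roots d i : (i \in roots d) = (0 < d i)%N.
Proof. by rewrite -has_pred1 has_count count_roots. Qed.

Lemma roots_edgeP d :
  uniq (roots d) && ([set a in roots d] \in edges H) = (d \in edge_ffun @: edges H).
Proof.
apply/andP/imsetP => [[ud dE]|[e eE ->]].
  exists [set a in roots d] => //; apply/ffunP => i; apply: val_inj => /=.
  by rewrite edge_ffunE inE -count_uniq_mem // count_roots.
have -> : [set a in roots (edge_ffun e)] = e.
  by apply/setP => i; rewrite inE mem_roots edge_ffunE; case: (i \in e).
split=> //; apply: count_mem_uniq => i.
by rewrite count_roots mem_roots edge_ffunE; case: (i \in e).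
Qed.

(** Every edge contributes equally: the weights [c] cancel the factorials in [K], and the prefactor
    of the trace absorbs its denominator. *)
Theorem trace_adjacency_tensor :
  tensor_trace k (adjacency_tensor F H) =
  (#|edges H| * k ^ k.-1 * k.-1 ^ (n - k))%:R%:MP.
Proof.
pose K : F := (k.-1)`!%:R ^+ k * k%:R ^+ k.-1 / k.-1%:R ^+ k.-1.
pose c (d : {ffun 'I_n -> 'I_k.+1}) : F := \prod_i (d i * k.-1)`!%:R^-1.
rewrite /tensor_trace.
rewrite (eq_bigr (fun d => c d *: foldr D (\tr (X ^+ (k * k.-1))) (roots d))); last first.
  by move=> d _; rewrite big_comp_tensor_op.
rewrite (eq_bigr (fun d => if d \in edge_ffun @: edges H then (c d * K)%:MP else 0)); last first.
  move=> d /eqP dk; rewrite foldr_tensor_op_tr ?size_roots // roots_edgeP.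
  by case: ifP => _; rewrite ?scaler0 // -mul_mpolyC -mpolyCM.
rewrite -big_mkcondr /= (eq_bigl (mem (edge_ffun @: edges H))) => [|d]; last first.
  apply: andb_idl => /imsetP[e eE ->]; apply/eqP.
  under eq_bigr do rewrite edge_ffunE.
  rewrite -(edges_card eE) -sum1_card [RHS]big_mkcond.
  by apply: eq_bigr => i _; case: ifP.
rewrite big_imset /=; last by move=> ? ? _ _; apply: edge_ffun_inj.
(* An edge is needed to have [k <= n], so that the truncated [n - k] is a true difference; without
   edges both sides are 0. *)
have [E0|[e0 e0E]] := set_0Vmem (edges H).
  by rewrite E0 big_set0 cards0 scaler0 !mul0n mpolyC0.
rewrite (eq_bigr (fun=> ((k.-1)`!%:R ^- k * K)%:MP)) => [|e eE].
  rewrite sumr_const -mul_mpolyC -[X in _ * X]mulr_natl -mpolyC_nat -!mpolyCM.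
  congr (_%:MP).
  have le_kn : (k <= n)%N by rewrite -(edges_card e0E) -[leqRHS]card_ord max_card.
  rewrite /K !natrM !natrX.
  have -> : n.-1 = (k.-1 + (n - k))%N by lia.
  rewrite exprD; field.
  by rewrite !expf_neq0 // pnatr_eq0 -?lt0n ?fact_gt0 //; lia.
congr ((_ * _)%:MP); rewrite /c (bigID (mem e)) /= mulrC big1 ?mul1r => [|i /negbTE ie].
  rewrite (eq_bigr (fun=> (k.-1)`!%:R^-1)) => [|i ie].
    by rewrite prodr_const (edges_card eE) exprVn.
  by rewrite edge_ffunE ie mul1n.
by rewrite edge_ffunE ie mul0n fact0 invr1.
Qed.

End AdjacencyTrace.

(** * Counting the edges of the hypercycle *)

Lemma hypercycle_edge_inj (m k : nat) : (2 < k)%N ->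
  injective (fun i : 'I_m => hypercycle_edge m k i).
Proof.
move=> k_gt2 i j eq_ij; have m_gt0 : (0 < m)%N by apply: leq_ltn_trans (ltn_ord i).
have lt_v : (i * k.-1 + 1 < m * k.-1)%N by have := ltn_ord i; nia.
(* The second vertex of an edge belongs to no other edge. *)
have : Ordinal lt_v \in hypercycle_edge m k i.
  rewrite inE; apply/existsP; exists (Ordinal (ltnW k_gt2)).
  by rewrite /= modn_small.
rewrite eq_ij inE => /existsP[t /eqP /= e].
have lt_j := ltn_ord j; have lt_t := ltn_ord t.
apply: val_inj => /=.
have [lt_jt|ge_jt] := ltnP (j * k.-1 + t) (m * k.-1).
  by move: e; rewrite modn_small //; nia.
(* Wrapping around happens only at the last vertex of the last edge, which is vertex 0 and hence not
   the second vertex of an edge. *)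
have e2 : (j * k.-1 + t = m * k.-1)%N by nia.
by move: e; rewrite e2 modnn addn1.
Qed.

Theorem theorem3p1 (C : numClosedFieldType) (k : nat) (hk : (3 <= k)%N) :
  tensor_trace k (adjacency_tensor C (hypercycle (isT : (1 < 4)%N) (ltnW hk)))
  = (4 * k ^ (k - 1) * (k - 1) ^ (3 * k - 4))%:R%:MP.
Proof.
rewrite (trace_adjacency_tensor _ _ (ltnW hk)) /= card_imset ?card_ord; last first.
  exact: hypercycle_edge_inj.
by rewrite subn1 (_ : 4 * k.-1 - k = 3 * k - 4)%N //; lia.
Qed.
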